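(* Let $M=(E,\mathcal{I})$ be a loopless matroid on a finite nonempty ground set $E$ with rank function $f$ and base family $\mathcal{B}$, with weights $\sigma\in\mathbb{R}^E_{>0}$, and let $m\in\mathbb{R}^E_{\ge 0}$ be the per-unit cost of decreasing the elements. Let $g(U)=f(E)-f(E\setminus U)$ for $U\subseteq E$ and let $\beta=S_\sigma(M)$ be the strength of $M$. Order $E=\{j_1,\dots,j_k\}$, $k=|E|$, so that $m(j_1)\le m(j_2)\le\dots\le m(j_k)$, and consider the following algorithm: start with $z=0\in\mathbb{R}^E$; for $i=1,2,\dots,k$ in turn, replace $$z(j_i)\ \leftarrow\ z(j_i)+\min\{(\sigma-z)(A)-\beta g(A): j_i\in A\subseteq E\};$$ return $z$. Then after each iteration the matroid $M$ with the new weights $\sigma-z$ has unchanged strength, i.e. $S_{\sigma-z}(M)=S_\sigma(M)$. When the algorithm terminates it outputs an optimal solution $z$ of the matroid sparsification problem $$\text{minimize } m\cdot z\quad\text{subject to } z\in\mathbb{R}^E_{\ge 0},\ \sigma-z\in\operatorname{conic}(\mathcal{B}),$$ and the matroid $M$ with weights $\sigma-z$ is homogeneous.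
   Context: For $x\in\mathbb{R}^E$ and $A\subseteq E$ write $x(A)=\sum_{e\in A}x(e)$ and $m\cdot z=\sum_{e}m(e)z(e)$. For a matroid $M$ with rank function $r$ and weights $w\in\mathbb{R}^E_{\ge 0}$, the strength is $S_w(M)=\min\{w(X)/(r(E)-r(E-X)): X\subseteq E,\ r(E)>r(E-X)\}$ and the fractional arboricity is $D_w(M)=\max\{w(X)/r(X): X\subseteq E,\ r(X)>0\}$. $M$ with weights $w$ is homogeneous if $S_w(M)=D_w(M)$. Bases are identified with their incidence vectors in $\mathbb{R}^E$, and $\operatorname{conic}(\mathcal{B})=\bigcup_{h>0}h\,\mathrm{co}(\mathcal{B})$ denotes the conical hull of these vectors, where $\mathrm{co}$ is the convex hull. *)

(* Defs.v *)
From HB Require Import structures.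
From mathcomp Require Import all_boot all_order all_algebra.

Set Implicit Arguments.
Unset Strict Implicit.
Unset Printing Implicit Defensive.

Import Order.TTheory GRing.Theory Num.Theory.
Local Open Scope ring_scope.

Record matroid (E : finType) := Matroid {
  indep : pred {set E};
  indep0 : indep set0;
  indepS : forall I J : {set E}, I \subset J -> indep J -> indep I;
  indep_augment : forall I J : {set E}, indep I -> indep J ->
    (#|I| < #|J|)%N -> exists2 e, e \in J :\: I & indep (e |: I)
}.

Section Matroid.
Variables (E : finType) (M : matroid E).

Definition rank (A : {set E}) : nat :=
  \max_(I : {set E} | (I \subset A) && indep M I) #|I|.

Definition bases : {set {set E}} := [set B | maxset (indep M) B].

Definition loopless : Prop := forall e : E, indep M [set e].

End Matroid.

Section Weights.
Variables (R : realFieldType) (E : finType).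
Implicit Types (w x z : {ffun E -> R}) (A X : {set E}).

Definition wt x A : R := \sum_(e in A) x e.

Definition dot x z : R := \sum_e x e * z e.

Definition incidence A : {ffun E -> R} := [ffun e => (e \in A)%:R].

Definition convex_hull (F : {set {set E}}) x : Prop :=
  exists c : {set E} -> R,
    [/\ forall B, B \in F -> 0 <= c B,
        \sum_(B in F) c B = 1
      & forall e, x e = \sum_(B in F) c B * incidence B e].

Definition conic (F : {set {set E}}) x : Prop :=
  exists2 h : R, 0 < h & exists2 y, convex_hull F y & forall e, x e = h * y e.

Variable M : matroid E.

Definition corank X : R := (rank M setT)%:R - (rank M (~: X))%:R.

(* In the next three definitions the minimum (maximum) ranges over a finite
   family containing X = E (for the first two, as soon as r(E) > 0), so taking
   the value at E as the initial value of the iterated operator adds nothing. *)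
Definition strength w : R :=
  \big[Num.min/ wt w setT / corank setT]_(X : {set E} | 0 < corank X)
    (wt w X / corank X).

Definition arboricity w : R :=
  \big[Num.max/ wt w setT / (rank M setT)%:R]_(X : {set E} | (0 < rank M X)%N)
    (wt w X / (rank M X)%:R).

Definition increment (sigma : {ffun E -> R}) (beta : R) z (j : E) : R :=
  let slack A := wt (sigma - z) A - beta * corank A in
  \big[Num.min/ slack setT]_(A : {set E} | j \in A) slack A.

Definition homogeneous w : Prop := strength w = arboricity w.

Definition step (sigma : {ffun E -> R}) (beta : R) z (j : E) : {ffun E -> R} :=
  [ffun e => if e == j then z j + increment sigma beta z j else z e].

Definition greedy (sigma : {ffun E -> R}) (s : seq E) : {ffun E -> R} :=
  foldl (step sigma (strength sigma)) 0 s.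

Definition feasible (sigma : {ffun E -> R}) z : Prop :=
  (forall e, 0 <= z e) /\ conic (bases M) (sigma - z).

Definition optimal (sigma m : {ffun E -> R}) z : Prop :=
  feasible sigma z /\ forall z', feasible sigma z' -> dot m z <= dot m z'.

End Weights.

(* Main.v *)
Require Import Defs.
From mathcomp Require Import all_boot all_order all_algebra.
From mathcomp Require Import reals.
From mathcomp Require Import ring lra.

(** Let beta be the strength of M under sigma and g the corank function.
    Nonnegative residual weights w = sigma - z of strength at least beta are
    exactly those with beta * g <= w on all sets.  The increment chosen for an
    element e is the largest that keeps these inequalities, so they hold
    throughout; as the weights only decrease, the strength cannot rise either,
    and it stays beta ([greedy_strength]).

    The step for e saturates some set through e (equality in beta * g <= w), and
    saturated sets stay saturated.  Since g is supermodular, they are closed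
    under union, so that after s has been processed a single saturated set
    contains s ([greedy_saturates]).  At the end this set is E, which gives
    w(E) = beta * r(E); passing to complements, beta * g <= w then becomes
    w <= beta * r.  Hence the arboricity is beta as well ([arboricity_eq]), and
    w / beta lies in the base polytope.

    That w / beta is a convex combination of bases is Edmonds' theorem on the
    base polytope ([base_polytope_sub_hull]), proved by induction on the number
    of sets that are not tight: a point with a fractional entry lies inside a
    segment of the polytope whose two ends have more tight sets, and a point
    without fractional entries is the incidence vector of a base.

    For optimality, a feasible z' has sigma - z' in h times the base polytope,
    and h <= beta because sigma - z' <= sigma ([conic_factor_le]).  By Abel
    summation along the increasing costs ([sorted_sum_ge0]), it is enough that
    on each suffix of the processing order the final residual weight of the
    algorithm is at least that of z'.  This follows from the saturated set that
    contains the complementary prefix ([suffix_dominates]). *)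

Set Implicit Arguments.
Unset Strict Implicit.
Unset Printing Implicit Defensive.

Import Order.TTheory GRing.Theory Num.Theory.
Local Open Scope ring_scope.

(** * The rank function of a matroid *)

Section Rank.
Variables (E : finType) (M : matroid E).
Implicit Types A B I J K : {set E}.

Lemma card_le_rank I A : indep M I -> I \subset A -> (#|I| <= rank M A)%N.
Proof. by move=> iI sIA; apply: leq_bigmax_cond; rewrite sIA iI. Qed.

Lemma extend_to_rank I A : indep M I -> I \subset A ->
  exists K, [/\ I \subset K, K \subset A, indep M K & #|K| = rank M A].
Proof.
move=> iI sIA; pose P := [pred K | indep M K && (K \subset A)].
have /(maxset_exists (P := P)) [K /maxsetP[/andP[iK sKA] maxK] sIK] : P I.
  by rewrite /P /= iI.
exists K; split=> //; apply/eqP; rewrite eqn_leq card_le_rank //= leqNgt.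
apply/negP; rewrite /rank (bigop.bigmax_eq_arg set0) ?sub0set ?indep0 //.
case: arg_maxnP => [|J /andP[sJA iJ] _ ltKJ]; first by rewrite sub0set indep0.
have [e /setDP[eJ eNK] ieK] := indep_augment iK iJ ltKJ.
have eKK : e |: K = K.
  by apply: maxK; rewrite ?subsetUr //= ieK subUset sub1set (subsetP sJA).
by move: eNK; rewrite -eKK setU11.
Qed.

Lemma rankS A B : A \subset B -> (rank M A <= rank M B)%N.
Proof.
move=> sAB; have [K [_ sKA iK <-]] := extend_to_rank (indep0 M) (sub0set A).
exact: card_le_rank (subset_trans sKA sAB).
Qed.

Lemma rank_le_card A : (rank M A <= #|A|)%N.
Proof.
have [K [_ sKA _ <-]] := extend_to_rank (indep0 M) (sub0set A).
exact: subset_leq_card.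
Qed.

Lemma rank_set0 : rank M set0 = 0%N.
Proof. by apply/eqP; rewrite -leqn0 -[leqRHS](@cards0 E) rank_le_card. Qed.

(** A maximal independent set I of A :&: B extends to a maximal independent set
    K of A :|: B; the traces of K on A and on B are independent, and they
    overlap at least in I. *)
Lemma rank_submod A B :
  (rank M (A :|: B) + rank M (A :&: B) <= rank M A + rank M B)%N.
Proof.
have [I [_ sI iI <-]] := extend_to_rank (indep0 M) (sub0set (A :&: B)).
have sIU : I \subset A :|: B.
  by apply: subset_trans sI (subset_trans (subsetIl _ _) (subsetUl _ _)).
have [K [sIK sK iK <-]] := extend_to_rank iI sIU.
have iKX X : indep M (K :&: X) by apply: indepS iK; apply: subsetIl.
have le1 := card_le_rank (iKX A) (subsetIr K A).
have le2 := card_le_rank (iKX B) (subsetIr K B).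
apply: leq_trans (leq_add le1 le2).
have -> : #|K| = #|(K :&: A) :|: (K :&: B)| by rewrite -setIUr (setIidPl sK).
rewrite -[leqRHS]cardsUI leq_add2l; apply: subset_leq_card.
by rewrite setIACA setIid subsetI sIK.
Qed.

Lemma card_base B : B \in bases M -> #|B| = rank M setT.
Proof.
rewrite inE => /maxsetP[iB maxB].
have [K [sBK _ iK <-]] := extend_to_rank iB (subsetT B).
by rewrite (maxB K).
Qed.

Lemma base_indep B : B \in bases M -> indep M B.
Proof. by rewrite inE => /maxsetP[]. Qed.

Lemma full_rank_base B : (rank M setT <= #|B|)%N -> (#|B| <= rank M B)%N ->
  B \in bases M.
Proof.
move=> leTB leBB.
have [K [_ sKB iK cK]] := extend_to_rank (indep0 M) (sub0set B).
have eKB : K = B by apply/eqP; rewrite eqEcard sKB cK.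
rewrite inE -eKB; apply/maxsetP; split=> // L iL sKL.
apply/esym/eqP; rewrite eqEcard sKL eKB /=.
exact: leq_trans (card_le_rank iL (subsetT L)) leTB.
Qed.

Lemma loopless_rank : loopless M -> (0 < #|E|)%N -> (0 < rank M setT)%N.
Proof.
move=> lM /card_gt0P[e _].
by have := card_le_rank (lM e) (subsetT _); rewrite cards1.
Qed.

End Rank.

(** * Modular set functions *)

Section Wt.
Variables (R : realFieldType) (E : finType).
Implicit Types (x y : {ffun E -> R}) (A B : {set E}).

Lemma wtE x A : wt x A = \sum_e x e * (e \in A)%:R.
Proof.
rewrite /wt big_mkcond; apply: eq_bigr => e _.
by case: (e \in A); rewrite ?mulr1 ?mulr0.
Qed.

Lemma sum_pred1 (T : finType) (A : {set T}) i :
  \sum_(e in A) (e == i)%:R = (i \in A)%:R :> R.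
Proof.
rewrite -natr_sum; congr (_ %:R); rewrite -big_mkcondr /=.
rewrite (eq_bigl (fun e => (i \in A) && (e == i))).
  by case: (i \in A) => /=; rewrite ?big_pred1_eq // big_pred0.
by move=> e; rewrite andbC; case: eqP => [->|]; rewrite ?andbF ?andbT.
Qed.

Lemma wt_set0 x : wt x set0 = 0.
Proof. exact: big_set0. Qed.

Lemma wtUI x A B : wt x (A :|: B) + wt x (A :&: B) = wt x A + wt x B.
Proof.
rewrite !wtE -!big_split /=; apply: eq_bigr => e _; rewrite !inE.
by case: (e \in A); case: (e \in B) => /=; ring.
Qed.

Lemma wtC x A : wt x (~: A) = wt x setT - wt x A.
Proof.
rewrite !wtE -sumrB; apply: eq_bigr => e _; rewrite !inE.
by case: (e \in A) => /=; ring.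
Qed.

Lemma wtB x y A : wt (x - y) A = wt x A - wt y A.
Proof. by rewrite /wt -sumrB; apply: eq_bigr => e _; rewrite !ffunE. Qed.

Lemma le_wt x y A : (forall e, x e <= y e) -> wt x A <= wt y A.
Proof. by move=> lexy; apply: ler_sum. Qed.

Lemma wt_incidence A B : wt (incidence R A) B = #|B :&: A|%:R.
Proof.
rewrite -sumr_const /wt [RHS]big_mkcond [LHS]big_mkcond; apply: eq_bigr => e _.
by rewrite ffunE inE; case: (e \in B); case: (e \in A).
Qed.

End Wt.

(** * The base polytope *)

Section BasePolytope.
Variables (R : realFieldType) (E : finType) (M : matroid E).
Implicit Types (x y z : {ffun E -> R}) (A B : {set E}) (i k e : E).

(** Nonnegativity follows from the rank bounds on complements of singletons
    ([base_polytope_ge0]), so that the inequalities are indexed by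
    sets alone. *)
Definition base_polytope x : Prop :=
  (forall A, wt x A <= (rank M A)%:R) /\ wt x setT = (rank M setT)%:R.

Definition tight x A : bool := wt x A == (rank M A)%:R.

Lemma base_polytope_ge0 x e : base_polytope x -> 0 <= x e.
Proof.
move=> [le_r eq_r]; have := le_r (~: [set e]).
have : (rank M (~: [set e]))%:R <= (rank M setT)%:R :> R.
  by rewrite ler_nat rankS ?subsetT.
have xe : wt x [set e] = x e by rewrite /wt big_set1.
rewrite wtC eq_r xe; lra.
Qed.

Lemma base_polytope_le1 x e : base_polytope x -> x e <= 1.
Proof.
move=> [le_r _]; have := le_r [set e]; rewrite /wt big_set1 => /le_trans-> //.
by rewrite -[leRHS]/(1%:R) ler_nat -(cards1 e) rank_le_card.
Qed.

Lemma tightI x A B : base_polytope x -> tight x A -> tight x B ->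
  tight x (A :&: B).
Proof.
move=> [le_r _] /eqP tA /eqP tB; have := rank_submod M A B.
rewrite -(ler_nat R) !natrD /tight; have := wtUI x A B; rewrite tA tB.
by have := le_r (A :|: B); have := le_r (A :&: B) => *; apply/eqP; lra.
Qed.

Definition shift x (t : R) i k : {ffun E -> R} :=
  [ffun e => x e + t * ((e == i)%:R - (e == k)%:R)].

Lemma wt_shift x t i k A :
  wt (shift x t i k) A = wt x A + t * ((i \in A)%:R - (k \in A)%:R).
Proof.
rewrite -(sum_pred1 R A i) -(sum_pred1 R A k) -sumrB mulr_sumr -big_split /=.
by apply: eq_bigr => e _; rewrite ffunE.
Qed.

(** A transfer of weight from k to i only affects sets that separate the two.
    None of them is tight at x, so that the transfer can go on until the first
    of them becomes tight. *)
Lemma shift_until_tight x i k : base_polytope x -> i != k ->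
    (forall A, tight x A -> (i \in A) = (k \in A)) ->
  exists t, [/\ 0 < t, base_polytope (shift x t i k) &
    [set A | tight x A] \proper [set A | tight (shift x t i k) A]].
Proof.
move=> [le_r eq_r] neq_ik nsep; pose slack A := (rank M A)%:R - wt x A.
pose sep A := (i \in A) && (k \notin A).
have sep1 : sep [set i] by rewrite /sep !inE eqxx eq_sym.
case: (arg_minP slack sep1) => A /andP[iA kNA] minA.
have pos : 0 < slack A.
  rewrite subr_gt0 lt_neqAle le_r andbT; apply/negP => /nsep.
  by rewrite iA (negPf kNA).
exists (slack A); split=> //.
  split=> [B|]; rewrite wt_shift ?inE; last by rewrite eq_r; ring.
  case sB: (sep B).
    have /andP[-> /negPf->] := sB; have := minA _ sB.
    by rewrite {2}/slack subr0 mulr1 lerBrDl addrC.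
  have : slack A * ((i \in B)%:R - (k \in B)%:R) <= 0.
    rewrite pmulr_rle0 // subr_le0 ler_nat; move: sB; rewrite /sep.
    by case: (i \in B); case: (k \in B).
  by have := le_r B; lra.
apply/properP; split.
  apply/subsetP => B; rewrite !inE => tB.
  by rewrite /tight wt_shift (nsep _ tB) subrr mulr0 addr0.
exists A; rewrite !inE.
  by apply/eqP; rewrite wt_shift iA (negPf kNA) /slack /=; ring.
by apply/negP => /nsep; rewrite iA (negPf kNA).
Qed.

Lemma convex_hull_mix (F : {set {set E}}) x y z (a b : R) :
    convex_hull F x -> convex_hull F y -> 0 < a -> 0 < b ->
    (forall e, z e = (a * x e + b * y e) / (a + b)) ->
  convex_hull F z.
Proof.
move=> [c [c0 c1 xE]] [d [d0 d1 yE]] a0 b0 zE.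
have ab0 : a + b != 0 by rewrite gt_eqF ?addr_gt0.
exists (fun B => (a * c B + b * d B) / (a + b)); split.
- move=> B FB; rewrite divr_ge0 ?addr_ge0 ?mulr_ge0 ?c0 ?d0 //; exact: ltW.
- by rewrite -mulr_suml big_split /= -!mulr_sumr c1 d1 !mulr1 divff.
- move=> e; rewrite zE xE yE !mulr_sumr -big_split /= mulr_suml.
  by apply: eq_bigr => B _; field.
Qed.

Lemma convex_hull_incidence (F : {set {set E}}) B x : B \in F ->
  (forall e, x e = (e \in B)%:R) -> convex_hull F x.
Proof.
move=> FB xE; exists (fun A => (A == B)%:R); split=> [A _||e].
- by case: eqP.
- by rewrite sum_pred1 FB.
rewrite (bigD1 B) //= eqxx mul1r ffunE xE big1 ?addr0 // => A /andP[_ /negPf->].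
by rewrite mul0r.
Qed.

(** On the base polytope this is the smallest tight set containing i, by
    [tightI]. *)
Definition tight_closure x i : {set E} :=
  \bigcap_(A | tight x A && (i \in A)) A.

Lemma mem_tight_closure x i : i \in tight_closure x i.
Proof. by apply/bigcapP => A /andP[]. Qed.

Lemma tight_closure_sub x i A : tight x A -> i \in A ->
  tight_closure x i \subset A.
Proof. by move=> tA iA; apply: bigcap_inf; rewrite tA. Qed.

Lemma tight_tight_closure x i : base_polytope x -> tight x (tight_closure x i).
Proof.
move=> Px; apply: (big_ind (tight x)) => [|A B|A /andP[] //].
  by case: Px => _ /eqP.
exact: tightI.
Qed.

Definition fractional x e : bool := (x e != 0) && (x e != 1).

(** The weight of the tight closure of i is an integer, so that x i cannot be
    its only fractional entry. *)
Lemma fractional_partner x i : base_polytope x -> fractional x i ->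
  exists k, [/\ k != i, k \in tight_closure x i & fractional x k].
Proof.
move=> Px /andP[xi0 xi1]; set T := tight_closure x i.
case: (pickP [pred k | [&& k != i, k \in T & fractional x k]]).
  by move=> k /and3P[]; exists k.
move=> no.
have xE e : e \in T -> e != i -> x e = (x e == 1)%:R.
  move=> eT ei; have := no e; rewrite /= eT ei /fractional /=.
  by case: eqP => [->|_]; case: eqP => [->|_] //=; rewrite eq_sym oner_eq0.
have /eqP := tight_tight_closure i Px.
rewrite -/T /wt (bigD1 i) ?mem_tight_closure //=.
rewrite (eq_bigr (fun e => (x e == 1)%:R)); last by move=> e /andP[]; apply: xE.
rewrite -natr_sum; set n := (\sum_(e in _ | _) _)%N => eqr.
have x0 : 0 < x i by rewrite lt_neqAle eq_sym xi0 base_polytope_ge0.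
have x1 : x i < 1 by rewrite lt_neqAle xi1 base_polytope_le1.
have : n%:R < (rank M T)%:R :> R by rewrite -eqr; lra.
have : (rank M T)%:R < n.+1%:R :> R by rewrite -eqr -natr1; lra.
by rewrite !ltr_nat ltnS => /leq_ltn_trans lt /lt; rewrite ltnn.
Qed.

Lemma integral_base_polytope x : base_polytope x ->
  (forall e, ~~ fractional x e) -> convex_hull (bases M) x.
Proof.
move=> [le_r eq_r] nfrac; pose B := [set e | x e == 1].
have xE e : x e = (e \in B)%:R.
  rewrite inE; have := nfrac e; rewrite /fractional.
  by case: eqP => [->|_]; case: eqP => [->|_] //=; rewrite eq_sym oner_eq0.
have wtx A : wt x A = #|A :&: B|%:R.
  by rewrite -wt_incidence; apply: eq_bigr => e _; rewrite xE ffunE.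
apply: (convex_hull_incidence _ xE); apply: full_rank_base.
  by rewrite -(ler_nat R) -eq_r wtx setTI.
by rewrite -(ler_nat R) -{1}(setIid B) -wtx.
Qed.

(** Edmonds' description of the hull of the bases.  At a point x with a
    fractional entry, take a fractional i with the smallest tight closure and
    another fractional k in that closure.  By minimality, i lies in the tight
    closure of k as well, so that no tight set separates i from k: x lies inside
    a segment with direction i - k whose ends have more tight sets than x. *)
Lemma base_polytope_sub_hull x : base_polytope x -> convex_hull (bases M) x.
Proof.
have [n] := ubnP #|~: [set A | tight x A]|.
elim: n x => // n IHn x lt_n Px.
case: (pickP (fractional x)) => [i0 fr0|nfrac]; last first.
  by apply: integral_base_polytope => // e; rewrite nfrac.
case: (arg_minnP (fun i => #|tight_closure x i|) fr0) => i fri mini.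
have [k [neq_ki kTi frk]] := fractional_partner Px fri.
have Ti := tight_tight_closure i Px; have Tk := tight_tight_closure k Px.
have iTk : i \in tight_closure x k.
  have sub := tight_closure_sub Ti kTi.
  have /eqP-> : tight_closure x k == tight_closure x i.
    by rewrite eqEcard sub mini.
  exact: mem_tight_closure.
have nsep A : tight x A -> (i \in A) = (k \in A).
  move=> tA; apply/idP/idP => [iA|kA].
    exact: subsetP (tight_closure_sub tA iA) k kTi.
  exact: subsetP (tight_closure_sub tA kA) i iTk.
have neq_ik : i != k by rewrite eq_sym.
have [t [t0 Pt lt_t]] := shift_until_tight Px neq_ik nsep.
have nsep' A : tight x A -> (k \in A) = (i \in A) by move/nsep.
have [u [u0 Pu lt_u]] := shift_until_tight Px neq_ki nsep'.
have more y : [set A | tight x A] \proper [set A | tight y A] ->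
    (#|~: [set A | tight y A]| < n)%N.
  rewrite -properC => /proper_card lt_y; rewrite -ltnS.
  exact: leq_ltn_trans lt_y lt_n.
have ut0 : u + t != 0 by rewrite gt_eqF ?addr_gt0.
have hull_t := IHn _ (more _ lt_t) Pt; have hull_u := IHn _ (more _ lt_u) Pu.
apply: (convex_hull_mix hull_t hull_u u0 t0).
by move=> e; rewrite !ffunE; field.
Qed.

Lemma hull_sub_base_polytope x : convex_hull (bases M) x -> base_polytope x.
Proof.
move=> [c [c0 c1 xE]].
have wtx A : wt x A = \sum_(B in bases M) c B * #|A :&: B|%:R.
  rewrite /wt; under eq_bigr do rewrite xE; rewrite exchange_big /=.
  by apply: eq_bigr => B _; rewrite -mulr_sumr -wt_incidence.
have avg r : r = \sum_(B in bases M) c B * r by rewrite -mulr_suml c1 mul1r.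
split=> [A|]; rewrite wtx.
  rewrite [leRHS]avg; apply: ler_sum => B bB; apply: ler_wpM2l; first exact: c0.
  rewrite ler_nat card_le_rank ?subsetIl //.
  exact: indepS (subsetIr A B) (base_indep bB).
by rewrite [RHS]avg; apply: eq_bigr => B bB; rewrite setTI (card_base bB).
Qed.

Lemma conicP x : conic (bases M) x <-> exists2 h : R, 0 < h &
  (forall A, wt x A <= h * (rank M A)%:R) /\ wt x setT = h * (rank M setT)%:R.
Proof.
split=> [[h h0 [y /hull_sub_base_polytope[le_r eq_r] xE]]|[h h0 [le_r eq_r]]].
  have wtx A : wt x A = h * wt y A.
    by rewrite /wt mulr_sumr; apply: eq_bigr => e _; rewrite xE.
  by exists h => //; split=> [A|]; rewrite wtx ?eq_r ?ler_pM2l.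
exists h => //; exists [ffun e => h^-1 * x e]; last first.
  by move=> e; rewrite ffunE mulVKf ?gt_eqF.
have wty A : wt [ffun e => h^-1 * x e] A = h^-1 * wt x A.
  by rewrite /wt mulr_sumr; apply: eq_bigr => e _; rewrite ffunE.
apply: base_polytope_sub_hull; split=> [A|]; rewrite wty.
  by rewrite ler_pdivrMl.
by rewrite eq_r mulKf ?gt_eqF.
Qed.

End BasePolytope.

(** * Strength and arboricity *)

Section Strength.
Variables (R : realFieldType) (E : finType) (M : matroid E).
Implicit Types (w : {ffun E -> R}) (A B X : {set E}).

Lemma corank_ge0 X : 0 <= corank R M X.
Proof. by rewrite subr_ge0 ler_nat rankS ?subsetT. Qed.

Lemma corank_set0 : corank R M set0 = 0.
Proof. by rewrite /corank setC0 subrr. Qed.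

Lemma corank_setT : corank R M setT = (rank M setT)%:R.
Proof. by rewrite /corank setCT rank_set0 subr0. Qed.

Lemma corankC A : corank R M (~: A) = (rank M setT)%:R - (rank M A)%:R.
Proof. by rewrite /corank setCK. Qed.

Lemma corank_supermod A B :
  corank R M A + corank R M B <= corank R M (A :|: B) + corank R M (A :&: B).
Proof.
have := rank_submod M (~: A) (~: B); rewrite -setCI -setCU.
by rewrite -(ler_nat R) !natrD /corank; lra.
Qed.

Hypothesis rank_gt0 : (0 < rank M setT)%N.

Let rankT_gt0 : 0 < (rank M setT)%:R :> R.
Proof. by rewrite ltr0n. Qed.

(** Sets of corank zero, over which the strength does not range, contribute
    only the condition that their weight is nonnegative. *)
Lemma strength_geP w b : (forall e, 0 <= w e) ->
  b <= strength M w <-> (forall A, b * corank R M A <= wt w A).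
Proof.
move=> w0; split=> [/bigmin_geP[_ le_b] A|le_b].
  have := corank_ge0 A; rewrite le_eqVlt => /predU1P[<-|gA].
    by rewrite mulr0 sumr_ge0.
  by rewrite -ler_pdivlMr // le_b.
apply/bigmin_geP; split=> [|A gA]; rewrite ler_pdivlMr ?le_b //.
by rewrite corank_setT.
Qed.

Lemma strength_mono w w' : (forall e, 0 <= w e) -> (forall e, w e <= w' e) ->
  strength M w <= strength M w'.
Proof.
move=> w0 le_w; have w'0 e : 0 <= w' e by apply: le_trans (le_w e).
apply/(strength_geP _ w'0) => A; apply: le_trans (le_wt A le_w).
by move: A; apply/strength_geP.
Qed.

Lemma strength_gt0 w : (forall e, 0 < w e) -> 0 < strength M w.
Proof.
move=> w0; have pos X : 0 < corank R M X -> 0 < wt w X / corank R M X.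
  move=> gX; rewrite divr_gt0 //; case: (set_0Vmem X) => [X0|[e eX]].
    by move: gX; rewrite X0 corank_set0 ltxx.
  rewrite /wt (bigD1 e) //= ltr_wpDr ?w0 //.
  by rewrite sumr_ge0 // => e' _; apply: ltW.
by apply/bigmin_gtP; split=> //; apply: pos; rewrite corank_setT.
Qed.

(** For a weight in b times the base polytope, lower bounds on the weight of
    the complements are the same as upper bounds on the weight of the sets. *)
Lemma corank_bound_rank w b : wt w setT = b * (rank M setT)%:R ->
  (forall A, b * corank R M A <= wt w A) <->
  (forall A, wt w A <= b * (rank M A)%:R).
Proof.
move=> eqT; split=> le_b A; have := le_b (~: A).
  by rewrite corankC wtC eqT; lra.
by rewrite wtC eqT /corank; lra.
Qed.

Lemma arboricity_eq w b : wt w setT = b * (rank M setT)%:R ->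
  (forall A, wt w A <= b * (rank M A)%:R) -> arboricity M w = b.
Proof.
move=> eqT le_b; have eqb : wt w setT / (rank M setT)%:R = b.
  by rewrite eqT mulfK ?gt_eqF.
apply/le_anti/andP; split.
  apply/bigmax_leP; split=> [|X rX]; first by rewrite eqb.
  by rewrite ler_pdivrMr ?ltr0n.
by rewrite -{1}eqb; apply: bigmax_ge_id.
Qed.

End Strength.

(** * The greedy algorithm *)

Section Greedy.
Variables (R : realFieldType) (E : finType) (M : matroid E).
Variable sigma : {ffun E -> R}.
Hypothesis rank_gt0 : (0 < rank M setT)%N.
Hypothesis sigma_gt0 : forall e, 0 < sigma e.
Implicit Types (z : {ffun E -> R}) (A T : {set E}) (s t : seq E) (e j : E).

Let beta := strength M sigma.
Let g := corank R M.

Let sigma_ge0 e : 0 <= sigma e.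
Proof. exact: ltW. Qed.

Let beta_gt0 : 0 < beta.
Proof. exact: strength_gt0. Qed.

(** The nonnegative residual weights sigma - z with this property are those of
    strength at least beta, by [strength_geP]; equality on E cuts out beta times
    the base polytope, by [corank_bound_rank]. *)
Definition bounded_below z : Prop := forall A, beta * g A <= wt (sigma - z) A.

Definition saturated z A : Prop := wt (sigma - z) A = beta * g A.

(** The excess of the residual weight over beta * g is nonnegative and, as g is
    supermodular, submodular: its zeros are closed under union. *)
Lemma saturatedU z A T : bounded_below z -> saturated z A -> saturated z T ->
  saturated z (A :|: T).
Proof.
rewrite /saturated => lb satA satT; have := wtUI (sigma - z) A T.
have := ler_wpM2l (ltW beta_gt0) (corank_supermod R M A T).
rewrite mulrDr [leRHS]mulrDr -!/(g _) satA satT.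
by have := lb (A :|: T); have := lb (A :&: T); lra.
Qed.

Lemma increment_le z j A : j \in A ->
  increment M sigma beta z j <= wt (sigma - z) A - beta * g A.
Proof. by move=> jA; apply: bigmin_le_cond. Qed.

Lemma increment_attained z j : exists2 A : {set E}, j \in A &
  increment M sigma beta z j = wt (sigma - z) A - beta * g A.
Proof.
pose attained v :=
  exists2 A : {set E}, j \in A & v = wt (sigma - z) A - beta * g A.
apply: (big_ind attained) => [|u v|A jA].
- by exists setT; rewrite ?inE.
- by move=> [A jA ->] [B jB ->]; rewrite minElt; case: ifP; [exists A|exists B].
- by exists A.
Qed.

Lemma wt_step z j A : wt (sigma - step M sigma beta z j) A =
  wt (sigma - z) A - increment M sigma beta z j * (j \in A)%:R.
Proof.
rewrite !wtB -(sum_pred1 R) mulr_sumr -addrA -opprD; congr (_ - _).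
rewrite /wt -big_split /=; apply: eq_bigr => e _; rewrite ffunE.
by case: eqP => [->|_]; rewrite ?mulr1 ?mulr0 ?addr0.
Qed.

Lemma greedy_rcons s j :
  greedy M sigma (rcons s j) = step M sigma beta (greedy M sigma s) j.
Proof. by rewrite /greedy foldl_rcons. Qed.

Lemma greedy_bounded_below s : bounded_below (greedy M sigma s).
Proof.
elim/last_ind: s => [|s j IHs] A.
  rewrite /greedy /= subr0; move: A; exact/strength_geP.
rewrite greedy_rcons wt_step; have := IHs A; case jA: (j \in A); last first.
  by rewrite mulr0 subr0.
by have := increment_le (greedy M sigma s) jA; rewrite mulr1; lra.
Qed.

Lemma greedy_out s e : e \notin s -> greedy M sigma s e = 0.
Proof.
elim/last_ind: s => [|s j IHs]; first by rewrite /greedy /= ffunE.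
rewrite mem_rcons inE negb_or greedy_rcons ffunE => /andP[/negPf-> /IHs].
by [].
Qed.

Lemma increment_ge0 z j : bounded_below z -> 0 <= increment M sigma beta z j.
Proof. by move=> lb; apply/bigmin_geP; split=> [|A _]; rewrite subr_ge0. Qed.

Lemma le_greedy_cat s t e : greedy M sigma s e <= greedy M sigma (s ++ t) e.
Proof.
elim/last_ind: t => [|t j IHt]; first by rewrite cats0.
apply: le_trans IHt _; rewrite -rcons_cat greedy_rcons ffunE.
case: eqP => // ->; rewrite lerDl increment_ge0 //.
exact: greedy_bounded_below.
Qed.

Lemma greedy_ge0 s e : 0 <= greedy M sigma s e.
Proof. by have := le_greedy_cat [::] s e; rewrite {1}/greedy /= ffunE. Qed.

Lemma residual_ge0 s e : 0 <= (sigma - greedy M sigma s) e.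
Proof.
have := greedy_bounded_below s [set e]; rewrite {1}/wt big_set1.
by apply: le_trans; rewrite mulr_ge0 ?corank_ge0 // ltW.
Qed.

Lemma residual_le s e : (sigma - greedy M sigma s) e <= sigma e.
Proof. by rewrite !ffunE gerDl oppr_le0 greedy_ge0. Qed.

(** Processing j saturates a set through j, the one that attains the minimum,
    and a saturated set stays saturated because its weight can no longer
    decrease. *)
Lemma greedy_saturates s : exists2 T : {set E},
  {subset s <= T} & saturated (greedy M sigma s) T.
Proof.
elim/last_ind: s => [|s j [T sT satT]].
  by exists set0 => //; rewrite /saturated wt_set0 /g corank_set0 mulr0.
set z := greedy M sigma s in satT *; set z' := greedy M sigma (rcons s j).
have lb' : bounded_below z' by apply: greedy_bounded_below.
have satT' : saturated z' T.
  apply: le_anti; rewrite lb' andbT -satT; apply: le_wt => e.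
  by rewrite !ffunE lerD2l lerN2 /z' -cats1 le_greedy_cat.
have [A jA eqA] := increment_attained z j.
have satA : saturated z' A.
  by rewrite /saturated /z' greedy_rcons wt_step jA eqA mulr1 subKr.
exists (T :|: A); last exact: saturatedU.
move=> e; rewrite mem_rcons !inE => /predU1P[->|/sT->] //.
by rewrite jA orbT.
Qed.

Lemma greedy_strength s : strength M (sigma - greedy M sigma s) = beta.
Proof.
apply: le_anti; rewrite strength_mono //; try exact: residual_ge0.
  apply/strength_geP => //; first exact: residual_ge0.
  exact: greedy_bounded_below.
exact: residual_le.
Qed.

(** No further decrease happens inside a set that is already saturated. *)
Lemma greedy_frozen s t T : saturated (greedy M sigma s) T ->
  forall e, e \in T -> greedy M sigma (s ++ t) e = greedy M sigma s e.
Proof.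
move=> satT e eT; apply/le_anti; rewrite le_greedy_cat andbT -subr_ge0.
have := greedy_bounded_below (s ++ t) T; rewrite -satT !wtB lerD2l lerN2.
rewrite /wt (bigD1 e) //= [leRHS](bigD1 e) //=.
have : \sum_(i in T | i != e) greedy M sigma s i <=
       \sum_(i in T | i != e) greedy M sigma (s ++ t) i.
  by apply: ler_sum => i _; apply: le_greedy_cat.
by lra.
Qed.

Lemma greedy_total s : s =i predT ->
  wt (sigma - greedy M sigma s) setT = beta * (rank M setT)%:R.
Proof.
move=> all_s; have [T sT] := greedy_saturates s.
have -> : T = setT by apply/setP => e; rewrite inE sT ?all_s.
by rewrite /saturated /g corank_setT.
Qed.

(** The core of the optimality proof.  Let w be the final residual weight, and T
    a saturated set that contains the prefix s.  On the part of t inside T the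
    algorithm leaves the weights at sigma, an upper bound for w'.  The rest of t
    is the whole complement of T, where w has total beta * rank (~: T), at least
    the bound h * rank (~: T) for w'. *)
Lemma suffix_dominates s t (w' : {ffun E -> R}) h :
    uniq (s ++ t) -> s ++ t =i predT -> h <= beta ->
    (forall A, wt w' A <= h * (rank M A)%:R) -> (forall e, w' e <= sigma e) ->
  \sum_(e <- t) w' e <= \sum_(e <- t) (sigma - greedy M sigma (s ++ t)) e.
Proof.
move=> uniq_st all_st le_h le_r le_sigma.
have [T sT satT] := greedy_saturates s.
set w := sigma - _.
have /and3P[_ /hasPn Nst uniq_t] : [&& uniq s, ~~ has (mem s) t & uniq t].
  by rewrite -cat_uniq.
have wT e : e \in T -> w e = sigma e - greedy M sigma s e.
  by move=> eT; rewrite !ffunE (greedy_frozen t satT eT).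
have eqwT : wt w T = beta * g T.
  by rewrite -satT; apply: eq_bigr => e /wT->; rewrite !ffunE.
have tN e : e \in ~: T -> e \in t.
  rewrite inE => eNT; have := all_st e; rewrite mem_cat.
  by case/orP => // /sT; rewrite (negPf eNT).
have eqwE : wt w setT = beta * (rank M setT)%:R.
  exact: greedy_total.
rewrite !big_uniq //= (bigID (mem T)) [leRHS](bigID (mem T)) /=.
apply: lerD.
  apply: ler_sum => e /andP[et eT]; rewrite wT // greedy_out ?subr0 //.
  exact: Nst.
have tT e : (e \in t) && (e \notin T) = (e \in ~: T).
  by rewrite andbC -in_setC; apply/andb_idr/tN.
rewrite (eq_bigl _ _ tT) [leRHS](eq_bigl _ _ tT).
rewrite -/(wt w' (~: T)) -/(wt w (~: T)); apply: le_trans (le_r _) _.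
have : h * (rank M (~: T))%:R <= beta * (rank M (~: T))%:R by rewrite ler_wpM2r.
by move/le_trans; apply; rewrite wtC eqwT eqwE /g /corank; lra.
Qed.

Lemma greedy_rank_bound s : s =i predT ->
  forall A, wt (sigma - greedy M sigma s) A <= beta * (rank M A)%:R.
Proof.
move=> /greedy_total/corank_bound_rank bound; apply/bound.
exact: greedy_bounded_below.
Qed.

Lemma greedy_feasible s : s =i predT -> feasible M sigma (greedy M sigma s).
Proof.
move=> all_s; split; first exact: greedy_ge0.
apply/conicP; exists beta => //; split; last exact: greedy_total.
exact: greedy_rank_bound.
Qed.

Lemma greedy_homogeneous s : s =i predT ->
  homogeneous M (sigma - greedy M sigma s).
Proof.
move=> all_s; rewrite /homogeneous greedy_strength.
apply/esym/arboricity_eq => //.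
  exact: greedy_total.
exact: greedy_rank_bound.
Qed.

(** A weight below sigma that lies in h times the base polytope has all its
    strength quotients at least h, and sigma has even larger ones. *)
Lemma conic_factor_le (w' : {ffun E -> R}) h : (forall e, w' e <= sigma e) ->
    (forall A, wt w' A <= h * (rank M A)%:R) ->
    wt w' setT = h * (rank M setT)%:R ->
  h <= beta.
Proof.
move=> le_sigma le_r eqT; apply/strength_geP => // A.
apply: le_trans (le_wt A le_sigma).
by move: A; apply/(corank_bound_rank eqT).
Qed.

(** Writing s = x :: s', the sum is (m x - c) times the total of d, plus the
    same sum over s' with m x in place of c: Abel summation. *)
Lemma sorted_sum_ge0 (m d : E -> R) s (c : R) :
    sorted (fun a b => m a <= m b) s -> {in s, forall e, c <= m e} ->
    (forall s1 s2, s = s1 ++ s2 -> 0 <= \sum_(e <- s2) d e) ->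
  0 <= \sum_(e <- s) (m e - c) * d e.
Proof.
elim: s c => [|x s IHs] c sorted_s le_c tail_ge0; first by rewrite big_nil.
have min_x : {in s, forall e, m x <= m e}.
  apply/allP; apply: order_path_min sorted_s => y z t; exact: le_trans.
have tail_s s1 s2 : s = s1 ++ s2 -> 0 <= \sum_(e <- s2) d e.
  by move=> def_s; apply: (tail_ge0 (x :: s1)); rewrite def_s.
have := IHs (m x) (path_sorted sorted_s) min_x tail_s.
have total : 0 <= (m x - c) * \sum_(e <- x :: s) d e.
  by rewrite mulr_ge0 ?(tail_ge0 [::]) // subr_ge0 le_c ?mem_head.
move=> rest; apply: le_trans (addr_ge0 total rest) _.
rewrite !big_cons mulrDr mulr_sumr -addrA -big_split /= lerD2l.
by apply: ler_sum => e _; rewrite -mulrDl addrC subrKA.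
Qed.

Lemma greedy_minimizes s (m : {ffun E -> R}) z' :
    uniq s -> s =i predT -> sorted (fun a b => m a <= m b) s ->
    (forall e, 0 <= m e) -> feasible M sigma z' ->
  dot m (greedy M sigma s) <= dot m z'.
Proof.
move=> uniq_s all_s sorted_s m0 [z'0 /conicP[h _ [le_r eqT]]].
have le_sigma e : (sigma - z') e <= sigma e by rewrite !ffunE gerDl oppr_le0.
have le_h := conic_factor_le le_sigma le_r eqT.
set z := greedy M sigma s.
rewrite -subr_ge0 /dot -sumrB.
rewrite (eq_bigr (fun e => (m e - 0) * (z' e - z e))); last first.
  by move=> e _; rewrite subr0 mulrBr.
rewrite (eq_bigl (mem s)) => [|e]; last by rewrite /= all_s.
rewrite -big_uniq //; apply: sorted_sum_ge0 => // s1 s2 def_s.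
move: uniq_s all_s; rewrite def_s => uniq_s all_s.
have := suffix_dominates uniq_s all_s le_h le_r le_sigma.
rewrite -subr_ge0 -sumrB /z def_s; congr (0 <= _).
by apply: eq_bigr => e _; rewrite !ffunE; ring.
Qed.

End Greedy.

Theorem theorem4p4 (R : realType) (E : finType) (M : matroid E)
    (sigma m : {ffun E -> R}) (j : #|E|.-tuple E)
    (E_nonempty : (0 < #|E|)%N)
    (M_loopless : loopless M)
    (sigma_gt0 : forall e, 0 < sigma e)
    (m_ge0 : forall e, 0 <= m e)
    (j_uniq : uniq j)
    (j_sorted : sorted (fun a b => m a <= m b) j) :
  [/\ forall i : nat, (i <= #|E|)%N ->
        let z := greedy M sigma (take i j) in
        (forall e, 0 <= (sigma - z) e) /\
        strength M (sigma - z) = strength M sigma,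
      optimal M sigma m (greedy M sigma j)
    & homogeneous M (sigma - greedy M sigma j)].
Proof.
have rank_gt0 := loopless_rank M_loopless E_nonempty.
have all_j : j =i predT.
  have sub_j : {subset j <= enum E} by move=> e _; rewrite mem_enum.
  have le_j : (size (enum E) <= size j)%N by rewrite size_tuple cardE.
  have [_ eq_j] := uniq_min_size j_uniq sub_j le_j.
  by move=> e; rewrite eq_j mem_enum.
split=> [i _ z||].
- by split; [exact: residual_ge0|exact: greedy_strength].
- by split; [exact: greedy_feasible|move=> z'; exact: greedy_minimizes].
- exact: greedy_homogeneous.
Qed.
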